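(* Let $\mathcal S\colon\mathtt C\to\mathtt{FVec}$ be a stem such that $A(c)\mathbin{\underline{\otimes}}A(d)\subseteq A(c\otimes d)$ holds for all $c,d\in\mathtt C$. Let $\mathcal G,\mathcal E$ be $\mathcal S$-systems on $X$ and $Y$, respectively. (i) Under the identification $X'\otimes Y=\mathrm{Lin}(X,Y)$ one has $(\mathcal G^\vee\mathbin{\overline{\otimes}}\mathcal E)(\mathbf 1)=\mathrm{CP}(\mathcal G,\mathcal E)$. (ii) Under the same identification, $(\mathcal G^\vee\mathbin{\underline{\otimes}}\mathcal E)(\mathbf 1^* )$ equals the closed conic hull of the set of linear maps $\Psi\colon X\to Y$ which admit a factorization $\Psi=\Psi_2\circ\Psi_1$ with $\Psi_1\in\mathrm{CP}(\mathcal G,\mathcal A_c)$ and $\Psi_2\in\mathrm{CP}(\mathcal B_c,\mathcal E)$ for some $c\in\mathtt C$.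
   Context: All vector spaces are finite-dimensional and real; $\mathtt{FVec}$ is the category of these with linear maps, $\mathrm{Lin}(V,W)$ is the space of linear maps, $V'=\mathrm{Lin}(V,\mathbb R)$. For a convex cone $C\subseteq V$, $C^\vee=\{\varphi\in V'\mid\varphi(x)\ge 0\ \forall x\in C\}$. For convex cones $C\subseteq V$, $D\subseteq W$: $C\mathbin{\underline{\otimes}}D=\{\sum_i c_i\otimes d_i\mid c_i\in C,d_i\in D\}\subseteq V\otimes W$ (finite sums). A star autonomous category is a symmetric monoidal category $(\mathtt C,\otimes,\mathbf 1)$ with a full and faithful functor ${}^*\colon\mathtt C^{\mathrm{op}}\to\mathtt C$ and a natural bijection $\mathtt C(a\otimes b,c)\cong\mathtt C(a,(b\otimes c^* )^* )$. Write $a\mathbin{\check\otimes}b:=(a^*\otimes b^* )^*$. $\mathtt{FVec}$ is star autonomous with the usual tensor product and dual. A stem is a star autonomous functor $\mathcal S\colon\mathtt C\to\mathtt{FVec}$, where $\mathtt C$ is star autonomous: i.e. a strong monoidal functor with natural isomorphisms $\mathcal S(c^* )\cong\mathcal S(c)'$, such that $\mathcal S$ carries the bijection $\mathtt C(a\otimes b,c)\cong\mathtt C(a,(b\otimes c^* )^* )$ to the corresponding bijection in $\mathtt{FVec}$. These isomorphisms are written as equalities: $\mathcal S(\mathbf 1)=\mathbb R$, $\mathcal S(\mathbf 1^* )=\mathbb R'=\mathbb R$, $\mathcal S(c\otimes d)=\mathcal S(c)\otimes\mathcal S(d)=\mathcal S(c\mathbin{\check\otimes}d)$, $\mathcal S(c^*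 )=\mathcal S(c)'$; also $X\otimes\mathcal S(\mathbf 1)=X=X\otimes\mathcal S(\mathbf 1^* )$. For $c\in\mathtt C$: $A(c)=\{v\in\mathcal S(c)\mid\mathcal S(\varphi)(v)\ge 0\ \forall\varphi\in\mathtt C(c,\mathbf 1^* )\}$ and $B(c)=\overline{\mathrm{cone}}\{\mathcal S(\Phi)(1)\mid\Phi\in\mathtt C(\mathbf 1,c)\}$ (closed conic hull). An $\mathcal S$-system $\mathcal G$ on $X$ is a family of closed convex cones $\mathcal G(c)\subseteq X\otimes\mathcal S(c)$, $c\in\mathtt C$, with $(\mathrm{id}_X\otimes\mathcal S(\Phi))(\mathcal G(c))\subseteq\mathcal G(d)$ for all $\Phi\in\mathtt C(c,d)$; systems on the same space are ordered and intersected level-wise. For $\mathcal S$-systems $\mathcal G$ on $X$ and $\mathcal E$ on $Y$, $\mathrm{CP}(\mathcal G,\mathcal E)$ is the set of $\Psi\in\mathrm{Lin}(X,Y)$ with $(\Psi\otimes\mathrm{id}_{\mathcal S(c)})(\mathcal G(c))\subseteq\mathcal E(c)$ for all $c$. The systems $\mathcal A_d,\mathcal B_d$ on $\mathcal S(d)$ are $\mathcal A_d(c)=A(d\otimes c)$, $\mathcal B_d(c)=B(d\mathbin{\check\otimes}c)$. The dual system of $\mathcal G$ is the system on $X'$ with $\mathcal G^\vee(c)=\mathcal G(c^* )^\vee$. Tensor products of $\mathcal S$-systems $\mathcal G_1$ on $X_1$ and $\mathcal G_2$ on $X_2$ are systems on $X_1\otimes X_2$: the maximal one is $$\mathcal G_1\mathbin{\overline{\otimes}}\mathcal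 G_2=\bigcap_{c_1,c_2\in\mathtt C,\ \Psi_i\in\mathrm{CP}(\mathcal G_i,\mathcal A_{c_i})}(\Psi_1\otimes\Psi_2)^{-1}(\mathcal A_{c_1\otimes c_2}),$$ where $(\Psi^{-1}(\mathcal E))(c)=(\Psi\otimes\mathrm{id}_{\mathcal S(c)})^{-1}(\mathcal E(c))$; the minimal one $\mathcal G_1\mathbin{\underline{\otimes}}\mathcal G_2$ is the smallest $\mathcal S$-system $\mathcal E$ on $X_1\otimes X_2$ with $\mathcal G_1(c_1)\mathbin{\underline{\otimes}}\mathcal G_2(c_2)\subseteq\mathcal E(c_1\otimes c_2)$ for all $c_1,c_2\in\mathtt C$. *)

(* Defs.v *)
From HB Require Import structures.
From mathcomp Require Import all_boot all_order all_algebra.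
From mathcomp Require Import all_classical all_reals all_analysis.

Set Implicit Arguments.
Unset Strict Implicit.
Unset Printing Implicit Defensive.

Import Order.TTheory GRing.Theory Num.Theory.
Import numFieldNormedType.Exports.

Local Open Scope classical_set_scope.
Local Open Scope ring_scope.

Declare Scope cat_scope.
Delimit Scope cat_scope with cat.

Record category := Category {
  obj :> Type;
  mor : obj -> obj -> Type;
  idm : forall a, mor a a;
  compm : forall a b c, mor b c -> mor a b -> mor a c;
  compmA : forall a b c d (h : mor c d) (g : mor b c) (f : mor a b),
    compm h (compm g f) = compm (compm h g) f;
  comp1m : forall a b (f : mor a b), compm (idm b) f = f;
  compm1 : forall a b (f : mor a b), compm f (idm a) = f
}.
Arguments mor {c0} a b : rename.
Arguments idm {c0} a : rename.

Notation "g ∘ f" := (compm g f) (at level 40, left associativity) : cat_scope.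
Local Open Scope cat_scope.

Definition is_iso (C : category) (a b : C) (f : mor a b) : Prop :=
  exists g : mor b a, g ∘ f = idm a /\ f ∘ g = idm b.

Reserved Notation "a ⊗ b" (at level 40, left associativity).
Reserved Notation "f ⊗m g" (at level 40, left associativity).

Record smcat := SMCat {
  smcat_cat :> category;
  tns : smcat_cat -> smcat_cat -> smcat_cat
    where "a ⊗ b" := (tns a b);
  tnsm : forall a a' b b' : smcat_cat,
    mor a a' -> mor b b' -> mor (a ⊗ b) (a' ⊗ b')
    where "f ⊗m g" := (tnsm f g);
  munit : smcat_cat;
  assoc : forall a b c : smcat_cat, mor (a ⊗ b ⊗ c) (a ⊗ (b ⊗ c));
  lunit : forall a : smcat_cat, mor (munit ⊗ a) a;
  runit : forall a : smcat_cat, mor (a ⊗ munit) a;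
  braid : forall a b : smcat_cat, mor (a ⊗ b) (b ⊗ a);
  tnsm_id : forall a b : smcat_cat, idm a ⊗m idm b = idm (a ⊗ b);
  tnsm_comp : forall (a a' a'' b b' b'' : smcat_cat)
    (f' : mor a' a'') (f : mor a a') (g' : mor b' b'') (g : mor b b'),
    (f' ∘ f) ⊗m (g' ∘ g) = (f' ⊗m g') ∘ (f ⊗m g);
  assoc_iso : forall a b c, is_iso (assoc a b c);
  assoc_nat : forall (a a' b b' c c' : smcat_cat)
    (f : mor a a') (g : mor b b') (h : mor c c'),
    assoc a' b' c' ∘ ((f ⊗m g) ⊗m h) = (f ⊗m (g ⊗m h)) ∘ assoc a b c;
  lunit_iso : forall a, is_iso (lunit a);
  lunit_nat : forall (a a' : smcat_cat) (f : mor a a'),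
    lunit a' ∘ (idm munit ⊗m f) = f ∘ lunit a;
  runit_iso : forall a, is_iso (runit a);
  runit_nat : forall (a a' : smcat_cat) (f : mor a a'),
    runit a' ∘ (f ⊗m idm munit) = f ∘ runit a;
  braid_nat : forall (a a' b b' : smcat_cat) (f : mor a a') (g : mor b b'),
    braid a' b' ∘ (f ⊗m g) = (g ⊗m f) ∘ braid a b;
  braidK : forall a b, braid b a ∘ braid a b = idm (a ⊗ b);
  pentagon : forall a b c d : smcat_cat,
    assoc a b (c ⊗ d) ∘ assoc (a ⊗ b) c d =
    (idm a ⊗m assoc b c d) ∘ assoc a (b ⊗ c) d ∘ (assoc a b c ⊗m idm d);
  triangle : forall a b : smcat_cat,
    (idm a ⊗m lunit b) ∘ assoc a munit b = runit a ⊗m idm b;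
  hexagon : forall a b c : smcat_cat,
    assoc b c a ∘ braid a (b ⊗ c) ∘ assoc a b c =
    (idm b ⊗m braid a c) ∘ assoc b a c ∘ (braid a b ⊗m idm c)
}.
Arguments munit {s}.
Arguments lunit {s} a.
Arguments runit {s} a.
Arguments braid {s} a b.
Arguments assoc {s} a b c.

Notation "a ⊗ b" := (tns a b) : cat_scope.
Notation "f ⊗m g" := (tnsm f g) : cat_scope.

Reserved Notation "c ^⋆" (at level 1, format "c ^⋆").

Record starcat := StarCat {
  starcat_smcat :> smcat;
  dob : starcat_smcat -> starcat_smcat
    where "c ^⋆" := (dob c);
  dmor : forall a b : starcat_smcat, mor a b -> mor (b^⋆) (a^⋆);
  dmor_id : forall a : starcat_smcat, dmor (idm a) = idm (a^⋆);
  dmor_comp : forall (a b c : starcat_smcat) (g : mor b c) (f : mor a b),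
    dmor (g ∘ f) = dmor f ∘ dmor g;
  dmor_bij : forall a b : starcat_smcat, bijective (@dmor a b);
  (* the bijection C(a ⊗ b, c) = C(a, (b ⊗ c^* )^* ), natural in a, b and c *)
  cur : forall a b c : starcat_smcat,
    mor (a ⊗ b) c -> mor a ((b ⊗ c^⋆)^⋆);
  cur_bij : forall a b c : starcat_smcat, bijective (@cur a b c);
  cur_natl : forall (a a' b c : starcat_smcat)
    (h : mor (a ⊗ b) c) (f : mor a' a),
    cur (h ∘ (f ⊗m idm b)) = cur h ∘ f;
  cur_natm : forall (a b b' c : starcat_smcat)
    (h : mor (a ⊗ b) c) (g : mor b' b),
    cur (h ∘ (idm a ⊗m g)) = dmor (g ⊗m idm (c^⋆)) ∘ cur h;
  cur_natr : forall (a b c c' : starcat_smcat)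
    (h : mor (a ⊗ b) c) (k : mor c c'),
    cur (k ∘ h) = dmor (idm b ⊗m dmor k) ∘ cur h
}.

Notation "c ^⋆" := (dob c) : cat_scope.

Definition par (C : starcat) (a b : C) : C := (a^⋆ ⊗ b^⋆)^⋆.
Notation "a ⅋ b" := (par a b) (at level 40, left associativity) : cat_scope.

(* Tensor products of finite-dimensional vector spaces, in coordinates with
   respect to the bases vbasis {:V}; the model is characterised by its universal
   property: pure is bilinear, tlift_pure and tens_ext. *)
Section LinearAlgebra.
Variable R : realType.
Implicit Types U V W X Y : vectType R.

Definition coords V : V -> 'rV[R]_(\dim {:V}) := passmx.rVof (vbasis {:V}).
Definition uncoords V : 'rV[R]_(\dim {:V}) -> V := passmx.vecof (vbasis {:V}).

Definition tens V W : vectType R := 'M[R]_(\dim {:V}, \dim {:W}).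

Definition pure V W (v : V) (w : W) : tens V W := (coords v)^T *m coords w.

Definition bilin V W U (b : V -> W -> U) : Prop :=
  (forall w, linear (b^~ w)) /\ (forall v, linear (b v)).

(* meaningful for bilinear b only, see tlift_pure *)
Definition tlift V W U (b : V -> W -> U) : 'Hom(tens V W, U) :=
  linfun (fun t : 'M[R]_(\dim {:V}, \dim {:W}) =>
    \sum_i \sum_j t i j *: b (vbasis {:V})`_i (vbasis {:W})`_j).

Definition tmap V V' W W' (f : 'Hom(V, V')) (g : 'Hom(W, W')) :
    'Hom(tens V W, tens V' W') :=
  tlift (fun v w => pure (f v) (g w)).

(* (V1 ⊗ W1) ⊗ (V2 ⊗ W2) -> (V1 ⊗ V2) ⊗ (W1 ⊗ W2) *)
Definition tswap V1 W1 V2 W2 :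
    'Hom(tens (tens V1 W1) (tens V2 W2), tens (tens V1 V2) (tens W1 W2)) :=
  tlift (fun (s : tens V1 W1) (t : tens V2 W2) =>
    tlift (fun (v1 : V1) (w1 : W1) =>
      tlift (fun (v2 : V2) (w2 : W2) => pure (pure v1 v2) (pure w1 w2)) t) s).

Definition ldual V : vectType R := 'Hom(V, R^o).

Definition ev V (phi : ldual V) (v : V) : R := phi v.

(* the identification X' ⊗ Y = Lin(X, Y), f ⊗ y |-> (x |-> f(x) y) *)
Definition tens_lin X Y : 'Hom(tens (ldual X) Y, 'Hom(X, Y)) :=
  tlift (fun (f : ldual X) (y : Y) => linfun (fun x : X => ev f x *: y)).

(* The Euclidean topology of a finite-dimensional space is that of its
   coordinate space. *)
Definition vclosed V (A : set V) : Prop :=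
  closed (@uncoords V @^-1` A).

Definition vclosure V (A : set V) : set V :=
  @coords V @^-1` closure (@uncoords V @^-1` A).

Definition convex_cone V (A : set V) : Prop :=
  [/\ A 0,
      forall x y, A x -> A y -> A (x + y)
    & forall (a : R) x, 0 <= a -> A x -> A (a *: x)].

Definition closed_convex_cone V (A : set V) : Prop :=
  convex_cone A /\ vclosed A.

Definition conic_hull V (A : set V) : set V :=
  [set x | exists (n : nat) (a : 'I_n -> R) (p : 'I_n -> V),
     [/\ forall i, 0 <= a i, forall i, A (p i) & x = \sum_i a i *: p i]].

Definition closed_conic_hull V (A : set V) : set V := vclosure (conic_hull A).

Definition dual_cone V (A : set V) : set (ldual V) :=
  [set phi | forall x, A x -> 0 <= ev phi x].

Definition cone_tens V W (A : set V) (B : set W) : set (tens V W) :=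
  [set t | exists (n : nat) (c : 'I_n -> V) (d : 'I_n -> W),
     [/\ forall i, A (c i), forall i, B (d i) & t = \sum_i pure (c i) (d i)]].

Lemma uncoordsK V : cancel (@uncoords V) (@coords V).
Proof. exact: passmx.vecofK (vbasisP _). Qed.

Lemma coordsK V : cancel (@coords V) (@uncoords V).
Proof. exact: passmx.rVofK (vbasisP _). Qed.

Lemma coords_linear V : linear (@coords V).
Proof. exact: passmx.rVof_linear. Qed.

Lemma pure_bilin V W : bilin (@pure V W).
Proof.
split=> [w|v] a x y; rewrite /pure coords_linear.
  by rewrite linearP /= mulmxDl -scalemxAl.
by rewrite mulmxDr -scalemxAr.
Qed.

Lemma tliftE V W U (b : V -> W -> U) (t : 'M[R]_(\dim {:V}, \dim {:W})) :
  tlift b t = \sum_i \sum_j t i j *: b (vbasis {:V})`_i (vbasis {:W})`_j.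
Proof.
pose h (t : 'M[R]_(\dim {:V}, \dim {:W})) : U :=
  \sum_i \sum_j t i j *: b (vbasis {:V})`_i (vbasis {:W})`_j.
have hP : linear h.
  move=> a s u; rewrite /h /= scaler_sumr -big_split /=.
  apply: eq_bigr => i _.
  rewrite scaler_sumr -big_split /=; apply: eq_bigr => j _.
  by rewrite !mxE scalerDl scalerA.
pose hL := GRing.isLinear.Build R _ _ _ h hP.
pose H : {linear 'M[R]_(\dim {:V}, \dim {:W}) -> U} := HB.pack h hL.
exact: (lfunE H t).
Qed.

Lemma bilin_sum V W U (b : V -> W -> U) (I J : finType) (x : I -> R)
    (v : I -> V) (y : J -> R) (w : J -> W) : bilin b ->
  b (\sum_i x i *: v i) (\sum_j y j *: w j) =
  \sum_i \sum_j (x i * y j) *: b (v i) (w j).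
Proof.
case=> bl br.
pose L w' : {linear V -> U} := HB.pack (b^~ w') (GRing.isLinear.Build R _ _ _ _ (bl w')).
pose Q v' : {linear W -> U} := HB.pack (b v') (GRing.isLinear.Build R _ _ _ _ (br v')).
rewrite -[LHS]/(L _ _) linear_sum; apply: eq_bigr => i _.
rewrite linearZ /= -[b _ _]/(Q _ _) linear_sum scaler_sumr; apply: eq_bigr => j _.
by rewrite linearZ /= scalerA.
Qed.

Lemma tlift_pure V W U (b : V -> W -> U) (v : V) (w : W) : bilin b ->
  tlift b (pure v w) = b v w.
Proof.
move=> bb; rewrite tliftE -[v in RHS]coordsK -[w in RHS]coordsK.
rewrite /uncoords /passmx.vecof bilin_sum //.
apply: eq_bigr => i _; apply: eq_bigr => j _.
by rewrite mxE big_ord1 mxE.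
Qed.

Lemma tens_sum V W (t : tens V W) :
  t = \sum_i \sum_j (t : 'M[R]_(\dim {:V}, \dim {:W})) i j *:
        pure (vbasis {:V})`_i (vbasis {:W})`_j.
Proof.
rewrite {1}[t](@matrix_sum_delta R); apply: eq_bigr => i _; apply: eq_bigr => j _.
congr (_ *: _); rewrite /pure /coords !passmx.rVofE ?vbasisP //.
by rewrite trmx_delta mul_delta_mx.
Qed.

Lemma tens_ext V W U (f g : 'Hom(tens V W, U)) :
  (forall v w, f (pure v w) = g (pure v w)) -> f = g.
Proof.
move=> fg; apply/lfunP => t; rewrite [t]tens_sum !linear_sum.
apply: eq_bigr => i _; rewrite !linear_sum; apply: eq_bigr => j _.
by rewrite !linearZ /= fg.
Qed.

Lemma tmap_pure V V' W W' (f : 'Hom(V, V')) (g : 'Hom(W, W')) v w :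
  tmap f g (pure v w) = pure (f v) (g w).
Proof.
have [pl pr] := @pure_bilin V' W'.
by rewrite tlift_pure //; split=> [y|y] a x z; rewrite linearP ?pl ?pr.
Qed.

End LinearAlgebra.

(* A strong monoidal functor to finite-dimensional spaces, with the structural
   isomorphisms that are informally written as equalities:
   seps for R = S(1), smu for S(a) ⊗ S(b) = S(a ⊗ b), skappa for S(c^* ) = S(c)'.
   The axioms are stated on pure tensors.  scur says that S carries
   C(a ⊗ b, c) = C(a, (b ⊗ c^* )^* ) to
   h |-> (u |-> (v ⊗ phi |-> phi(h(u ⊗ v)))).
   No compatibility with the braidings is required. *)
Record stem (R : realType) (C : starcat) := Stem {
  sob :> C -> vectType R;
  smor : forall a b : C, mor a b -> 'Hom(sob a, sob b);
  smor_id : forall (a : C) v, smor (idm a) v = v;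
  smor_comp : forall (a b c : C) (g : mor b c) (f : mor a b) v,
    smor (g ∘ f) v = smor g (smor f v);
  seps : 'Hom(R^o, sob munit);
  seps_bij : bijective seps;
  smu : forall a b : C, 'Hom(tens (sob a) (sob b), sob (a ⊗ b));
  smu_bij : forall a b, bijective (smu a b);
  smu_nat : forall (a a' b b' : C) (f : mor a a') (g : mor b b') u v,
    smor (f ⊗m g) (smu a b (pure u v)) =
    smu a' b' (pure (smor f u) (smor g v));
  smu_assoc : forall (a b c : C) u v w,
    smor (assoc a b c) (smu (a ⊗ b) c (pure (smu a b (pure u v)) w)) =
    smu a (b ⊗ c) (pure u (smu b c (pure v w)));
  smu_lunit : forall (a : C) (r : R) v,
    smor (lunit a) (smu munit a (pure (seps r) v)) = r *: v;
  smu_runit : forall (a : C) (r : R) v,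
    smor (runit a) (smu a munit (pure v (seps r))) = r *: v;
  skappa : forall c : C, 'Hom(sob (c^⋆), ldual (sob c));
  skappa_bij : forall c, bijective (skappa c);
  skappa_nat : forall (c d : C) (f : mor c d) w v,
    ev (skappa c (smor (dmor f) w)) v = ev (skappa d w) (smor f v);
  scur : forall (a b c : C) (h : mor (a ⊗ b) c) u v w,
    ev (skappa (b ⊗ c^⋆) (smor (cur h) u)) (smu b (c^⋆) (pure v w)) =
    ev (skappa c w) (smor h (smu a b (pure u v)))
}.
Arguments smor {R C} s {a b} _.
Arguments seps {R C} s.
Arguments smu {R C} s a b.
Arguments skappa {R C} s c.

Section Systems.
Variables (R : realType) (C : starcat) (S : stem R C).
Implicit Types X Y : vectType R.

(* S(1) = R *)
Definition unit_val : 'Hom(S munit, R^o) := ((seps S)^-1)%VF.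

(* S(1^* ) = S(1)' = R' = R *)
Definition bot_val : 'Hom(S (munit^⋆), R^o) :=
  linfun (fun w : S (munit^⋆) => ev (skappa S munit w) (seps S 1) : R^o).

(* S(c) ⊗ S(d) = (S(c)' ⊗ S(d)')' = (S(c^* ) ⊗ S(d^* ))' = S(c^* ⊗ d^* )'
   = S(c ⅋ d) *)
Definition spar (c d : C) : 'Hom(tens (S c) (S d), S (c ⅋ d)) :=
  ((skappa S (c^⋆ ⊗ d^⋆))^-1 \o
   tlift (fun (v : S c) (w : S d) =>
     (tlift (fun (f : S (c^⋆)) (g : S (d^⋆)) =>
        ev (skappa S c f) v * ev (skappa S d g) w : R^o)
      \o (smu S (c^⋆) (d^⋆))^-1)%VF : ldual (S (c^⋆ ⊗ d^⋆))))%VF.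

(* X ⊗ S(1) = X and X ⊗ S(1^* ) = X *)
Definition at_unit X : 'Hom(tens X (S munit), X) :=
  tlift (fun (x : X) (w : S munit) => (unit_val w : R) *: x).

Definition at_bot X : 'Hom(tens X (S (munit^⋆)), X) :=
  tlift (fun (x : X) (w : S (munit^⋆)) => (bot_val w : R) *: x).

Definition Acone (c : C) : set (S c) :=
  [set v | forall phi : mor c (munit^⋆), 0 <= (bot_val (smor S phi v) : R)].

Definition Bcone (c : C) : set (S c) :=
  closed_conic_hull [set v | exists Phi : mor munit c, v = smor S Phi (seps S 1)].

Arguments Acone : clear implicits.
Arguments Bcone : clear implicits.

Definition sfamily X := forall c : C, set (tens X (S c)).

Definition is_system X (G : sfamily X) : Prop :=
  (forall c, closed_convex_cone (G c)) /\
  (forall (c d : C) (Phi : mor c d) t,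
     G c t -> G d (tmap \1%VF (smor S Phi) t)).

Definition CP X Y (G : sfamily X) (E : sfamily Y) : set 'Hom(X, Y) :=
  [set Psi | forall (c : C) t, G c t -> E c (tmap Psi \1%VF t)].

Definition Asys (d : C) : sfamily (S d) :=
  fun c => [set t | Acone (d ⊗ c) (smu S d c t)].

Definition Bsys (d : C) : sfamily (S d) :=
  fun c => [set t | Bcone (d ⅋ c) (spar d c t)].

Arguments Asys : clear implicits.
Arguments Bsys : clear implicits.

(* X' ⊗ S(c) = (X ⊗ S(c)')' = (X ⊗ S(c^* ))' *)
Definition dual_id X (c : C) :
    'Hom(tens (ldual X) (S c), ldual (tens X (S (c^⋆)))) :=
  tlift (fun (f : ldual X) (v : S c) =>
    tlift (fun (x : X) (w : S (c^⋆)) => ev f x * ev (skappa S c w) v : R^o)).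

Definition dual_sys X (G : sfamily X) : sfamily (ldual X) :=
  fun c => [set t | dual_cone (G (c^⋆)) (dual_id X c t)].

Definition preim_sys X Y (Psi : 'Hom(X, Y)) (E : sfamily Y) : sfamily X :=
  fun c => [set t | E c (tmap Psi \1%VF t)].
Arguments preim_sys {X Y} Psi E c _.

(* Psi1 ⊗ Psi2 takes values in S(c1) ⊗ S(c2) = S(c1 ⊗ c2). *)
Definition max_tens X1 X2 (G1 : sfamily X1) (G2 : sfamily X2) :
    sfamily (tens X1 X2) :=
  fun c => [set t | forall (c1 c2 : C)
      (Psi1 : 'Hom(X1, S c1)) (Psi2 : 'Hom(X2, S c2)),
    CP G1 (Asys c1) Psi1 -> CP G2 (Asys c2) Psi2 ->
    preim_sys (smu S c1 c2 \o tmap Psi1 Psi2)%VF (Asys (c1 ⊗ c2)) c t].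

(* G1(c1) ⊗ G2(c2), seen in (X1 ⊗ X2) ⊗ S(c1 ⊗ c2), lies in E(c1 ⊗ c2). *)
Definition contains_tens X1 X2 (G1 : sfamily X1) (G2 : sfamily X2)
    (E : sfamily (tens X1 X2)) : Prop :=
  forall (c1 c2 : C) t, cone_tens (G1 c1) (G2 c2) t ->
    E (c1 ⊗ c2) (tmap \1%VF (smu S c1 c2) (tswap X1 (S c1) X2 (S c2) t)).

Definition min_tens X1 X2 (G1 : sfamily X1) (G2 : sfamily X2) :
    sfamily (tens X1 X2) :=
  fun c => [set t | forall E : sfamily (tens X1 X2),
    is_system E -> contains_tens G1 G2 E -> E c t].

Arguments dual_sys {X} G c _.
Arguments max_tens {X1 X2} G1 G2 c _.
Arguments min_tens {X1 X2} G1 G2 c _.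

Lemma min_tens_le X1 X2 (G1 : sfamily X1) (G2 : sfamily X2)
    (E : sfamily (tens X1 X2)) :
  is_system E -> contains_tens G1 G2 E -> forall c, min_tens G1 G2 c `<=` E c.
Proof. by move=> sE cE c t; apply. Qed.

Lemma min_tens_contains X1 X2 (G1 : sfamily X1) (G2 : sfamily X2) :
  contains_tens G1 G2 (min_tens G1 G2).
Proof. by move=> c1 c2 t Gt E sE; apply. Qed.

Lemma min_tens_system X1 X2 (G1 : sfamily X1) (G2 : sfamily X2) :
  is_system (min_tens G1 G2).
Proof.
split=> [c|c d Phi t tm E sE cE]; last by apply: (sE.2); exact: tm.
split; first split.
- by move=> E [/(_ c)[[]]].
- move=> x y mx my E sE cE; have [[_ h _] _] := sE.1 c.
  by apply: h; [exact: mx|exact: my].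
- move=> a x a0 mx E sE cE; have [[_ _ h] _] := sE.1 c.
  by apply: h => //; exact: mx.
move=> r mr E sE cE; apply: ((sE.1 c).2 r); apply: closure_subset mr => z mz.
by apply: mz.
Qed.

End Systems.

Arguments Acone {R C} S c _.
Arguments Bcone {R C} S c _.
Arguments Asys {R C} S d c _.
Arguments Bsys {R C} S d c _.
Arguments dual_sys {R C S X} G c _.
Arguments preim_sys {R C S X Y} Psi E c _.
Arguments max_tens {R C S X1 X2} G1 G2 c _.
Arguments min_tens {R C S X1 X2} G1 G2 c _.
Arguments at_unit {R C} S X.
Arguments at_bot {R C} S X.

(* Main.v *)
Require Import Defs.
From HB Require Import structures.
From mathcomp Require Import all_boot all_order all_algebra.
From mathcomp Require Import all_classical all_reals all_analysis.
From mathcomp Require Import ring lra.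

Set Implicit Arguments.
Unset Strict Implicit.
Unset Printing Implicit Defensive.

Import Order.TTheory GRing.Theory Num.Theory.
Import numFieldNormedType.Exports.

Local Open Scope classical_set_scope.
Local Open Scope ring_scope.
Local Open Scope cat_scope.

(** Everything rests on translating positivity statements about tensors into
    statements about linear maps, and morphisms [a ⊗ b -> 1^⋆] into morphisms
    [a -> b^⋆].  Write [<w, v>] for the pairing of [S c^⋆] with [S c].  The star
    autonomous structure provides morphisms whose images under [S] are the
    expected maps: the canonical isomorphism [c -> c^⋆^⋆] and its inverse
    ([bidual], [bidual_inv]), the transposes [a -> b^⋆] and [b -> a^⋆] of a
    pairing [a ⊗ b -> 1^⋆] ([pairing_transpose], [pairing_transpose_swap]), the
    evaluation [c ⊗ c^⋆ -> 1^⋆] and the coevaluation [1 -> c ⅋ c^⋆]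
    ([evaluation], [coevaluation]).

    With these, a tensor in [X' ⊗ S c] lies in [G^∨ c] exactly when the
    associated map [X -> S c] is in [CP(G, A_c)] ([CP_Asys_dual_sys],
    [dual_sys_CP_Asys]), a tensor in [G c] gives a map [X' -> S c] in
    [CP(G^∨, A_c)] ([slice_CP]), and a functional that is nonnegative on [E c]
    gives a map [Y -> S c^⋆] in [CP(E, A_(c^⋆))] ([functional_map_CP]).

    (i) Let [Psi] come from an element of the maximal tensor product.  By the
    bipolar theorem ([bipolar]), [(Psi ⊗ id)(t)] lies in [E c] for [t] in [G c]
    as soon as [phi((Psi ⊗ id)(t)) >= 0] for all [phi] in [(E c)^∨].  This number
    is obtained by applying to [Psi], seen as a tensor in [X' ⊗ Y], the maps
    [X' -> S c] and [Y -> S c^⋆] given by [t] and [phi], and then evaluating; it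
    is nonnegative by definition of the maximal tensor product.  Conversely, if
    [Psi], [Psi2] are completely positive, then so is [Psi2 o Psi : X -> S c2],
    which is therefore a tensor in [G^∨ c2], and any [Psi1] in [CP(G^∨, A_c1)]
    sends it into [A (c1 ⊗ c2)].

    (ii) An element of the minimal tensor product at [1^⋆] is built from elements
    [s] of [G^∨ c1], [t] of [E c2] and a pairing [c1 ⊗ c2 -> 1^⋆].  Contracting
    [s ⊗ t] with the pairing gives the composite of the map [X -> S c1] of [s],
    which is in [CP(G, A_c1)], with a map [S c1 -> Y], which is in
    [CP(B_c1, E)]: morphisms [1 -> c1 ⅋ e] amount to morphisms [c1^⋆ -> e], so
    on the generators of the cone this map only moves [t] by a morphism
    [c2 -> e] ([bot_contraction], [contr_CP]).  Conversely, a map [Psi2] in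
    [CP(B_c, E)] applied to the coevaluation gives an element of [E c^⋆] from
    which [Psi2] is recovered by evaluation ([contr_identity_tens]). *)

(** * Closed convex cones and the bipolar theorem *)

Section ClosedCones.
Variable R : realType.
Implicit Types V W : vectType R.

Lemma linear_lfunE V W (f : V -> W) (v : V) : linear f -> linfun f v = f v.
Proof.
move=> fP; pose F : {linear V -> W} := HB.pack f (GRing.isLinear.Build R _ _ _ _ fP).
exact: (lfunE F).
Qed.

Lemma linear_rV_continuous (n : nat) (W : normedModType R)
  (f : 'rV[R]_n -> W) : linear f -> continuous f.
Proof.
move=> fP; pose F : {linear 'rV[R]_n -> W} :=
  HB.pack f (GRing.isLinear.Build R _ _ _ _ fP).
have -> : f = fun x => \sum_(i < n) x 0 i *: f (delta_mx 0 i).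
  apply/funext => x; rewrite {1}[x]row_sum_delta -[LHS]/(F _) linear_sum.
  by apply: eq_bigr => i _; rewrite linearZ.
apply: continuous_big => [|i _]; first exact: add_continuous.
suff h (w : W) : continuous (fun y : 'rV[R]_n => y 0 i *: w) by exact: h.
move=> y; apply: (@cvgZr_tmp _ _ _ (nbhs y)); exact: coord_continuous.
Qed.

HB.instance Definition _ V :=
  GRing.isLinear.Build R V 'rV[R]_(\dim {:V}) _ (@coords R V) (@coords_linear R V).

Lemma uncoords_linear V : linear (@uncoords R V).
Proof. exact: passmx.vecof_linear. Qed.

HB.instance Definition _ V :=
  GRing.isLinear.Build R 'rV[R]_(\dim {:V}) V _ (@uncoords R V) (@uncoords_linear V).

(** The translation by [w] is what makes closures of cones stable under addition. *)
Lemma vclosed_preimage V W (f : 'Hom(V, W)) (w : W) (B : set W) :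
  vclosed B -> vclosed [set x | B (f x + w)].
Proof.
move=> Bcl; pose g (x : 'rV[R]_(\dim {:V})) := coords (f (uncoords x) + w).
have gc : continuous g.
  have -> : g = fun x => coords (f (uncoords x)) + coords w.
    by apply/funext => x; rewrite /g linearD.
  move=> x; apply: (@cvgD _ _ _ (nbhs x)); last exact: cvg_cst.
  apply: linear_rV_continuous => a y z.
  by rewrite !linearP.
have -> : [set x | B (f x + w)] = @coords R V @^-1` (g @^-1` (@uncoords R W @^-1` B)).
  by apply/funext => x; rewrite /preimage /= /g !coordsK.
rewrite /vclosed.
have -> : @uncoords R V @^-1` (@coords R V @^-1` (g @^-1` (@uncoords R W @^-1` B)))
  = g @^-1` (@uncoords R W @^-1` B).
  by apply/funext => x; rewrite /preimage /= uncoordsK.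
by apply: closed_comp => // x _; exact: gc.
Qed.

Lemma vclosure_closed V (A : set V) : vclosed (vclosure A).
Proof.
rewrite /vclosed /vclosure.
rewrite (_ : _ @^-1` _ = closure (@uncoords R V @^-1` A)); first exact: closed_closure.
by apply/funext => x; rewrite /preimage /= uncoordsK.
Qed.

Lemma sub_vclosure V (A : set V) : A `<=` vclosure A.
Proof. by move=> x Ax; apply: subset_closure; rewrite /preimage /= coordsK. Qed.

Lemma vclosure_min V (A B : set V) : A `<=` B -> vclosed B -> vclosure A `<=` B.
Proof.
move=> AB Bcl x Ax; rewrite -[x]coordsK; apply: Bcl.
by apply: closureS Ax => y; exact: AB.
Qed.

Lemma convex_cone_sum V (A : set V) (n : nat) (p : 'I_n -> V) :
  convex_cone A -> (forall i, A (p i)) -> A (\sum_i p i).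
Proof. by case=> A0 AD _ Ap; elim/big_ind: _. Qed.

Lemma conic_hull_cone V (A : set V) : convex_cone (conic_hull A).
Proof.
split.
- exists 0%N, (fun=> 0), (fun=> 0); split=> [[]//|[]//|]; by rewrite big_ord0.
- move=> x y [n [a [p [a0 Ap ->]]]] [m [b [q [b0 Aq ->]]]].
  exists (n + m)%N, (fun i => match fintype.split i with inl j => a j | inr j => b j end),
    (fun i => match fintype.split i with inl j => p j | inr j => q j end).
  split=> [i|i|]; [by case: fintype.split|by case: fintype.split|].
  rewrite big_split_ord /=; congr (_ + _); apply: eq_bigr => i _.
    by rewrite -[lshift _ _]/(unsplit (inl i)) unsplitK.
  by rewrite -[rshift _ _]/(unsplit (inr i)) unsplitK.
- move=> c x c0 [n [a [p [a0 Ap ->]]]].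
  exists n, (fun i => c * a i), p; split=> // [i|]; first exact: mulr_ge0.
  by rewrite scaler_sumr; apply: eq_bigr => i _; rewrite scalerA.
Qed.

(** Addition is extended to the closure one argument at a time: a translation is
    continuous, so translating first by elements of [A], then by elements of the
    closure, maps [A], hence its closure, into the closure. *)
Lemma vclosure_cone V (A : set V) : convex_cone A -> closed_convex_cone (vclosure A).
Proof.
move=> [A0 AD AZ]; have cl := @vclosure_closed V A; have sub := @sub_vclosure V A.
split=> //; split; first exact: sub.
- have step k x : A k -> vclosure A x -> vclosure A (x + k).
    move=> Ak; have := vclosed_preimage (f := \1%VF) (w := k) cl.
    move/(vclosure_min (A := A)) => h /h; rewrite /= id_lfunE; apply.
    by move=> y Ay /=; rewrite id_lfunE; apply: sub; exact: AD.
  move=> x y Ax; have := vclosed_preimage (f := \1%VF) (w := x) cl.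
  move/(vclosure_min (A := A)) => h /h; rewrite /= id_lfunE addrC; apply.
  by move=> z Az /=; rewrite id_lfunE addrC; exact: step.
- move=> a x a0; have := vclosed_preimage (f := a *: \1%VF) (w := 0) cl.
  move/(vclosure_min (A := A)) => h /h; rewrite /= addr0 scale_lfunE id_lfunE.
  apply=> z Az /=; rewrite addr0 scale_lfunE id_lfunE.
  by apply: sub; exact: AZ.
Qed.

Lemma closed_conic_hull_cone V (A : set V) :
  closed_convex_cone (closed_conic_hull A).
Proof. exact: vclosure_cone (conic_hull_cone A). Qed.

Lemma sub_closed_conic_hull V (A : set V) : A `<=` closed_conic_hull A.
Proof.
move=> x Ax; apply: sub_vclosure; exists 1%N, (fun=> 1), (fun=> x).
by split=> //; rewrite big_ord1 scale1r.
Qed.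

Lemma closed_conic_hull_min V (A B : set V) :
  closed_convex_cone B -> A `<=` B -> closed_conic_hull A `<=` B.
Proof.
move=> [Bc Bcl] AB; apply: vclosure_min Bcl => x [n [a [p [a0 Ap ->]]]].
have [_ _ BZ] := Bc.
by apply: convex_cone_sum => // i; apply: BZ => //; exact: AB.
Qed.

Lemma closed_convex_cone_preimage V W (f : 'Hom(V, W)) (B : set W) :
  closed_convex_cone B -> closed_convex_cone [set x | B (f x)].
Proof.
move=> [[B0 BD BZ] Bcl]; split; first split.
- by rewrite /= linear0.
- by move=> x y Bx By; rewrite /= linearD; exact: BD.
- by move=> a x a0 Bx; rewrite /= linearZ; exact: BZ.
have := vclosed_preimage (f := f) (w := 0) Bcl.
by under eq_fun do rewrite addr0.
Qed.

Lemma closed_convex_cone_bigcap V (I : Type) (K : I -> set V) :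
  (forall i, closed_convex_cone (K i)) -> closed_convex_cone [set x | forall i, K i x].
Proof.
move=> Kc; split; first split.
- by move=> i; have [[]] := Kc i.
- by move=> x y Kx Ky i; have [[_ h _] _] := Kc i; exact: h.
- by move=> a x a0 Kx i; have [[_ _ h] _] := Kc i; exact: h.
move=> x xK i; have [_ icl] := Kc i; apply: icl.
by apply: closureS xK => y /(_ i).
Qed.

(** If [x] is not in [K], let [p] be a point of [K] nearest to [x] in coordinates.
    The inner product with [p - x] is nonnegative on [K] and negative at [x]. *)
Lemma bipolar V (K : set V) (x : V) : closed_convex_cone K ->
  (forall phi : ldual V, dual_cone K phi -> 0 <= ev phi x) -> K x.
Proof.
move=> [[K0 KD KZ] Kcl] Kx; apply: contrapT => nKx.
set n := \dim {:V}; pose K' : set 'rV[R]_n := @uncoords R V @^-1` K.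
pose ip (u v : 'rV[R]_n) := \sum_i u 0 i * v 0 i.
pose q (z : 'rV[R]_n) := ip (z - coords x) (z - coords x).
have ipl u : linear (ip u : 'rV[R]_n -> R^o).
  move=> a y z; rewrite /ip scaler_sumr -big_split; apply: eq_bigr => i _ /=.
  by rewrite !mxE /GRing.scale /=; ring.
have ip0 u : 0 <= ip u u by apply: sumr_ge0 => i _; exact: sqr_ge0.
have qc : continuous q.
  apply: continuous_big => [|i _]; first exact: add_continuous.
  have h : continuous (fun y : 'rV[R]_n => (y - coords x) 0 i).
    have -> : (fun y : 'rV[R]_n => (y - coords x) 0 i) =
              fun y => y 0 i - coords x 0 i by apply/funext => y; rewrite !mxE.
    move=> y; apply: (@cvgB _ _ _ (nbhs y)); last exact: cvg_cst.
    exact: coord_continuous.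
  by move=> z; apply: (@cvgM _ _ (nbhs z)); exact: h.
pose D := K' `&` [set z | q z <= q 0].
have Dcl : closed D.
  apply: closedI => //; apply: (@closed_comp _ _ q [set r | r <= q 0]) => [z _|].
    exact: qc.
  exact: closed_le.
have Dbd : bounded_set D.
  exists (`|coords x| + (q 0 + 1)); split=> [|M /ltW leM z [_ /= zq]].
    exact: num_real.
  apply: le_trans leM.
  have -> : z = coords x + (z - coords x) by rewrite addrC subrK.
  apply: le_trans (ler_normD _ _) _; rewrite lerD //.
  rewrite [leLHS]/Num.norm /= mx_normrE; apply/bigmax_leP; split.
    by rewrite addr_ge0 //; exact: ip0.
  move=> [i j] _ /=; rewrite ord1.
  have : `|(z - coords x) 0 j| ^+ 2 <= q z.
    rewrite real_normK ?num_real // /q /ip (bigD1 j) //= expr2 lerDl.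
    by apply: sumr_ge0 => k _; exact: sqr_ge0.
  have := ip0 (0 - coords x); rewrite -/(q 0); move: zq (normr_ge0 ((z - coords x) 0 j)).
  by move: `|_| (q z) (q 0) => r a b; nra.
have [|p /set_mem [pK pq] pmin] := EVT_min_rV (A := D) _ (bounded_closed_compact Dbd Dcl)
  (continuous_subspaceT qc).
  by exists 0; split; [rewrite /K' /preimage /= linear0|exact: lexx].
have {}pmin z : K' z -> q p <= q z.
  move=> Kz; have [zq|zq] := leP (q z) (q 0); first by apply: pmin; exact/mem_set.
  exact: le_trans pq (ltW zq).
pose u := p - coords x.
have qpE : q p = ip u u by [].
have expand (t : R) k : q (p + t *: k) = q p + 2 * t * ip u k + t ^+ 2 * ip k k.
  have -> : q (p + t *: k) = ip (u + t *: k) (u + t *: k) by rewrite /q addrAC.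
  rewrite qpE /ip !mulr_sumr -!big_split; apply: eq_bigr => i _ /=.
  by rewrite !mxE; ring.
(* First-order condition at the minimizer p, in every direction k along which a
   short segment from p stays in the cone. *)
have var k : (exists2 e, 0 < e & forall t, 0 < t -> t <= e -> K' (p + t *: k)) ->
    0 <= ip u k.
  move=> [e e0 Kt]; rewrite leNgt; apply/negP => neg.
  have kk := ip0 k.
  pose t := Num.min e (- ip u k / (ip k k + 1)).
  have t0 : 0 < t by rewrite lt_min e0 divr_gt0 // ?oppr_gt0 //; lra.
  have te : t <= e by rewrite ge_min lexx.
  have tk : t * (ip k k + 1) <= - ip u k.
    by rewrite -ler_pdivlMr ?ge_min ?lexx ?orbT //; lra.
  have := pmin _ (Kt t t0 te); rewrite expand => h.
  have : 0 <= t * (2 * ip u k + t * ip k k) by lra.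
  by rewrite pmulr_rge0 //; nra.
have posK k : K' k -> 0 <= ip u k.
  move=> Kk; apply: var; exists 1 => // t t0 _; rewrite /K' /preimage /= linearD linearZ.
  by apply: KD => //; apply: KZ => //; exact: ltW.
have up : ip u p <= 0.
  have : 0 <= ip u (- p).
    apply: var; exists 1 => // t t0 t1.
    have -> : p + t *: (- p) = (1 - t) *: p by rewrite scalerBl scale1r scalerN.
    by rewrite /K' /preimage /= linearZ; apply: KZ => //; lra.
  suff -> : ip u (- p) = - ip u p by rewrite oppr_ge0.
  by rewrite /ip -sumrN; apply: eq_bigr => i _; rewrite [(- p) 0 i]mxE mulrN.
have philin : linear (fun v : V => ip u (coords v) : R^o).
  by move=> a v w; rewrite coords_linear ipl.
pose phi : ldual V := linfun (fun v : V => ip u (coords v) : R^o).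
have FE (v : V) : ev phi v = ip u (coords v) by rewrite /ev linear_lfunE.
have := Kx phi _; rewrite FE => /(_ _) H.
have {}H : 0 <= ip u (coords x).
  by apply: H => y Ky; rewrite FE; apply: posK; rewrite /K' /preimage /= coordsK.
have : ip u u = ip u p - ip u (coords x).
  by rewrite -sumrB; apply: eq_bigr => i _; rewrite -mulrBr {2}/u !mxE.
have u0 : 0 < ip u u.
  rewrite lt_def ip0 andbT; apply/eqP => uu0; apply: nKx.
  suff ->: x = uncoords p by [].
  rewrite -[LHS]coordsK; congr uncoords; apply/eqP; rewrite eq_sym -subr_eq0 -/u.
  apply/eqP/rowP => i; rewrite [RHS]mxE; apply/eqP; rewrite -sqrf_eq0.
  have /psumr_eq0P : forall i : 'I_n, true -> 0 <= u 0 i * u 0 i by move=> j _; exact: sqr_ge0.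
  by move/(_ uu0 i isT) => <-; rewrite expr2.
by lra.
Qed.

End ClosedCones.

(** * Linear maps and tensors *)

Section Tensors.
Variable R : realType.
Implicit Types U V W X Y Z : vectType R.

Lemma lfunD V W (f : 'Hom(V, W)) v w : f (v + w) = f v + f w.
Proof. exact: linearD. Qed.

Lemma lfunZ V W (f : 'Hom(V, W)) a v : f (a *: v) = a *: f v.
Proof. exact: linearZ. Qed.

Lemma lfun_sum V W (f : 'Hom(V, W)) (I : finType) (v : I -> V) :
  f (\sum_i v i) = \sum_i f (v i).
Proof. exact: linear_sum. Qed.

Lemma evDl V (f g : ldual V) v : ev (f + g) v = ev f v + ev g v.
Proof. by rewrite /ev add_lfunE. Qed.

Lemma evZl V a (f : ldual V) v : ev (a *: f) v = a * ev f v.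
Proof. by rewrite /ev scale_lfunE. Qed.

Lemma evDr V (f : ldual V) v w : ev f (v + w) = ev f v + ev f w.
Proof. by rewrite /ev linearD. Qed.

Lemma evZr V (f : ldual V) a v : ev f (a *: v) = a * ev f v.
Proof. by rewrite /ev linearZ. Qed.

Lemma ev_suml V (I : finType) (f : I -> ldual V) v : ev (\sum_i f i) v = \sum_i ev (f i) v.
Proof. by rewrite /ev sum_lfunE. Qed.

Lemma ev_sumr V (I : finType) (f : ldual V) (v : I -> V) : ev f (\sum_i v i) = \sum_i ev f (v i).
Proof. by rewrite /ev linear_sum. Qed.

Lemma ldual_ext V (f g : ldual V) : (forall v, ev f v = ev g v) -> f = g.
Proof. by move=> fg; apply/lfunP => v; exact: fg. Qed.

Lemma pureDl V W (v v' : V) (w : W) : pure (v + v') w = pure v w + pure v' w.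
Proof. by have := (pure_bilin V W).1 w 1 v v'; rewrite !scale1r. Qed.

Lemma pureDr V W (v : V) (w w' : W) : pure v (w + w') = pure v w + pure v w'.
Proof. by have := (pure_bilin V W).2 v 1 w w'; rewrite !scale1r. Qed.

Lemma pure0l V W (w : W) : pure (0 : V) w = 0.
Proof. by apply: (addIr (pure 0 w)); rewrite -pureDl !add0r. Qed.

Lemma pure0r V W (v : V) : pure v (0 : W) = 0.
Proof. by apply: (addIr (pure v 0)); rewrite -pureDr !add0r. Qed.

Lemma pureZl V W a (v : V) (w : W) : pure (a *: v) w = a *: pure v w.
Proof. by have := (pure_bilin V W).1 w a v 0; rewrite pure0l !addr0. Qed.

Lemma pureZr V W a (v : V) (w : W) : pure v (a *: w) = a *: pure v w.
Proof. by have := (pure_bilin V W).2 v a w 0; rewrite pure0r !addr0. Qed.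

Lemma pure_suml V W (I : finType) (v : I -> V) (w : W) :
  pure (\sum_i v i) w = \sum_i pure (v i) w.
Proof. by elim/big_rec2: _ => [|i y z _ <-]; rewrite ?pure0l ?pureDl. Qed.

(** Identities between linear expressions in a tensor need only be checked on pure
    tensors; scalars and zero are absorbed in the pure tensors. *)
Lemma tens_ind V W (P : tens V W -> Prop) :
  (forall s t, P s -> P t -> P (s + t)) -> (forall v w, P (pure v w)) ->
  forall t, P t.
Proof.
move=> PD Pp t; have P0 : P 0 by rewrite -(pure0l V 0); exact: Pp.
rewrite [t]tens_sum; elim/big_ind: _ => // i _; elim/big_ind: _ => // j _.
by rewrite -pureZl.
Qed.

Lemma bilin_linfun U V W X (g : V -> W -> X -> U) :
  (forall v w, linear (g v w)) -> (forall x, bilin (fun v w => g v w x)) ->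
  bilin (fun v w => linfun (g v w)).
Proof.
move=> gl gb; split=> [w|v] a x y; apply/lfunP => z;
  rewrite add_lfunE scale_lfunE !linear_lfunE //.
- exact: (gb z).1.
- exact: (gb z).2.
Qed.

(** This and the next lemma verify the bilinearity of iterated lifts. *)
Lemma tlift_linear U0 V W U (b : U0 -> V -> W -> U) :
  (forall v w, linear (fun u => b u v w)) -> linear (fun u => tlift (b u)).
Proof.
move=> bl a x y; apply/lfunP => t; rewrite add_lfunE scale_lfunE !tliftE.
rewrite scaler_sumr -big_split; apply: eq_bigr => i _ /=.
rewrite scaler_sumr -big_split; apply: eq_bigr => j _ /=.
by rewrite bl scalerDr !scalerA mulrC.
Qed.

Lemma tlift_bilin V0 W0 V W U (b : V0 -> W0 -> V -> W -> U) :
  (forall v w, bilin (fun x y => b x y v w)) ->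
  bilin (fun x y => tlift (b x y)).
Proof.
by move=> bb; split=> z; apply: tlift_linear => v w; have [bl br] := bb v w.
Qed.

Lemma ev_bilin V W (f : ldual V) (g : ldual W) :
  bilin (fun v w => ev f v * ev g w : R^o).
Proof.
split=> [w|v] a x y; rewrite evDr evZr /GRing.scale /=; ring.
Qed.

Lemma tmap_linearr V V' W W' (f : 'Hom(V, V')) :
  linear (fun g : 'Hom(W, W') => tmap f g).
Proof.
apply: tlift_linear => v w a g h.
by rewrite add_lfunE scale_lfunE pureDr pureZr.
Qed.

Lemma tmap_linearl V V' W W' (g : 'Hom(W, W')) :
  linear (fun f : 'Hom(V, V') => tmap f g).
Proof.
apply: tlift_linear => v w a f h.
by rewrite add_lfunE scale_lfunE pureDl pureZl.
Qed.

Lemma tmapDl V V' W W' (f f' : 'Hom(V, V')) (g : 'Hom(W, W')) t :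
  tmap (f + f') g t = tmap f g t + tmap f' g t.
Proof. by have := tmap_linearl g 1 f f'; rewrite !scale1r => ->; rewrite add_lfunE. Qed.

Lemma tmap_comp V V' V'' W W' W'' (f' : 'Hom(V', V'')) (f : 'Hom(V, V'))
    (g' : 'Hom(W', W'')) (g : 'Hom(W, W')) t :
  tmap (f' \o f)%VF (g' \o g)%VF t = tmap f' g' (tmap f g t).
Proof.
elim/tens_ind: t => [s t IHs IHt|v w]; first by rewrite !lfunD IHs IHt.
by rewrite !tmap_pure !comp_lfunE.
Qed.

Lemma pure_pure_bilin V1 W1 V2 W2 (v2 : V2) (w2 : W2) :
  bilin (fun (v1 : V1) (w1 : W1) => pure (pure v1 v2) (pure w1 w2)).
Proof. by split=> z a x y; rewrite !(pureDl, pureDr, pureZl, pureZr). Qed.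

Lemma tswap_pure V1 W1 V2 W2 (v1 : V1) (w1 : W1) (v2 : V2) (w2 : W2) :
  tswap V1 W1 V2 W2 (pure (pure v1 w1) (pure v2 w2)) =
  pure (pure v1 v2) (pure w1 w2).
Proof.
pose b (v1 : V1) (w1 : W1) (v2 : V2) (w2 : W2) := pure (pure v1 v2) (pure w1 w2).
have br (x : V1) (y : W1) : bilin (b x y).
  by split=> z a u v; rewrite /b !(pureDl, pureDr, pureZl, pureZr).
have bl : bilin (fun x y => tlift (b x y)).
  by apply: tlift_bilin => v w; exact: pure_pure_bilin.
have bt t : bilin (fun x y => tlift (b x y) t).
  by split=> z a x y; [rewrite bl.1|rewrite bl.2]; rewrite add_lfunE scale_lfunE.
rewrite /tswap tlift_pure ?(tlift_pure _ _ (bt _)) ?tlift_pure //.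
split=> [t|s] a x y; first exact: linearP.
have l : linear (fun t => tlift (fun x y => tlift (b x y) t)).
  by apply: tlift_linear => v w c t u; rewrite lfunD lfunZ.
by rewrite l add_lfunE scale_lfunE.
Qed.

Lemma tens_lin_pure X Y (f : ldual X) (y : Y) x :
  tens_lin X Y (pure f y) x = ev f x *: y.
Proof.
have l (g : ldual X) (z : Y) : linear (fun x => ev g x *: z).
  by move=> a u v; rewrite evDr evZr scalerDl scalerA.
rewrite /tens_lin tlift_pure ?linear_lfunE //; apply: bilin_linfun => // u.
split=> [z|g] a v w; first by rewrite evDl evZl scalerDl scalerA.
by rewrite scalerDr !scalerA mulrC.
Qed.

Definition dual_basis V (i : 'I_(\dim {:V})) : ldual V :=
  linfun (coord (vbasis {:V}) i : V -> R^o).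

Lemma dual_basis_sum V (v : V) :
  v = \sum_i ev (dual_basis i) v *: (vbasis {:V})`_i.
Proof.
rewrite {1}(coord_vbasis (memvf v)); apply: eq_bigr => i _.
by rewrite /ev lfunE.
Qed.

Lemma ldual_basis_sum V (f : ldual V) :
  f = \sum_(i < \dim {:V}) ev f (vbasis {:V})`_i *: dual_basis i.
Proof.
apply: ldual_ext => v; rewrite ev_suml {1}(dual_basis_sum v) ev_sumr.
by apply: eq_bigr => i _; rewrite evZr evZl mulrC.
Qed.

(** The tensor of a linear map, inverse to [tens_lin] ([lin_tensK], [tens_linK]). *)
Definition lin_tens X Y (Psi : 'Hom(X, Y)) : tens (ldual X) Y :=
  \sum_i pure (dual_basis i) (Psi (vbasis {:X})`_i).

Lemma lin_tensK X Y : cancel (@lin_tens X Y) (tens_lin X Y).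
Proof.
move=> Psi; apply/lfunP => x; rewrite /lin_tens lfun_sum sum_lfunE.
rewrite [x in RHS]dual_basis_sum lfun_sum.
by apply: eq_bigr => i _; rewrite tens_lin_pure lfunZ.
Qed.

Lemma tens_linK X Y : cancel (tens_lin X Y) (@lin_tens X Y).
Proof.
elim/tens_ind => [s t IHs IHt|f y].
  rewrite -{2}IHs -{2}IHt lfunD /lin_tens -big_split; apply: eq_bigr => i _ /=.
  by rewrite add_lfunE pureDr.
rewrite [f in RHS]ldual_basis_sum /lin_tens pure_suml.
by apply: eq_bigr => i _; rewrite tens_lin_pure pureZl pureZr.
Qed.

Lemma tmap_lin_tens X Y Z (f : 'Hom(Y, Z)) (Psi : 'Hom(X, Y)) :
  tmap \1%VF f (lin_tens Psi) = lin_tens (f \o Psi)%VF.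
Proof.
rewrite /lin_tens lfun_sum; apply: eq_bigr => i _.
by rewrite tmap_pure id_lfunE comp_lfunE.
Qed.

(** Elements of [X ⊗ V] as linear maps [X' -> V]. *)
Definition slice X V : 'Hom(tens X V, 'Hom(ldual X, V)) :=
  tlift (fun (x : X) (v : V) => linfun (fun f : ldual X => ev f x *: v)).

Lemma slice_pure X V (x : X) (v : V) f : slice X V (pure x v) f = ev f x *: v.
Proof.
have l (y : X) (u : V) : linear (fun f : ldual X => ev f y *: u).
  by move=> a g h; rewrite evDl evZl scalerDl scalerA.
rewrite /slice tlift_pure ?linear_lfunE //; apply: bilin_linfun => // g.
split=> [z|y] a v' w; first by rewrite evDr evZr scalerDl scalerA.
by rewrite scalerDr !scalerA mulrC.
Qed.

(** Contraction of [Y ⊗ W] with a bilinear form on [V × W], as a map [V -> Y]. *)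
Definition contr V W Y (beta : ldual (tens V W)) : 'Hom(tens Y W, 'Hom(V, Y)) :=
  tlift (fun (y : Y) (w : W) => linfun (fun v : V => ev beta (pure v w) *: y)).

Lemma contr_pure V W Y (beta : ldual (tens V W)) (y : Y) w v :
  contr Y beta (pure y w) v = ev beta (pure v w) *: y.
Proof.
have l (z : Y) (u : W) : linear (fun v : V => ev beta (pure v u) *: z).
  by move=> a g h; rewrite pureDl pureZl evDr evZr scalerDl scalerA.
rewrite /contr tlift_pure ?linear_lfunE //; apply: bilin_linfun => // g.
split=> [z|z] a v' w'; last by rewrite pureDr pureZr evDr evZr scalerDl scalerA.
by rewrite scalerDr !scalerA mulrC.
Qed.

Definition curry V W (phi : ldual (tens V W)) : 'Hom(V, ldual W) :=
  linfun (fun v : V => linfun (fun w : W => ev phi (pure v w) : R^o) : ldual W).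

Lemma curryE V W (phi : ldual (tens V W)) v w :
  ev (curry phi v) w = ev phi (pure v w).
Proof.
have l u : linear (fun w : W => ev phi (pure u w) : R^o).
  by move=> a g h; rewrite pureDr pureZr evDr evZr.
have e u z : ev (linfun (fun w : W => ev phi (pure u w) : R^o) : ldual W) z =
    ev phi (pure u z) by rewrite {1}/ev linear_lfunE.
rewrite /curry linear_lfunE ?e // => a g h; apply: ldual_ext => z.
by rewrite evDl evZl !e pureDl pureZl evDr evZr.
Qed.

End Tensors.

(** * Canonical morphisms of a star autonomous category, seen through a stem *)

Section BijectiveLfun.
Variable R : realType.
Implicit Types V W : vectType R.

Lemma bij_lfunK V W (f : 'Hom(V, W)) : bijective f -> cancel f (f^-1)%VF.
Proof. by move=> /bij_inj /lker0P; exact: lker0_lfunK. Qed.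

Lemma bij_lfunVK V W (f : 'Hom(V, W)) : bijective f -> cancel (f^-1)%VF f.
Proof.
by move=> [g _ gK] w; rewrite limg_lfunVK // -[w]gK; exact: memv_img (memvf _).
Qed.

End BijectiveLfun.

Section Stem.
Variables (R : realType) (C : starcat) (S : stem R C).
Implicit Types X Y : vectType R.

Local Notation pair w v := (ev (skappa S _ w) v).
Local Notation mu u v := (smu S _ _ (pure u v)).
Local Notation eps r := (seps S r).

Lemma kappaK c : cancel (skappa S c) ((skappa S c)^-1)%VF.
Proof. exact: bij_lfunK (skappa_bij S c). Qed.

Lemma kappaVK c : cancel ((skappa S c)^-1)%VF (skappa S c).
Proof. exact: bij_lfunVK (skappa_bij S c). Qed.

Lemma bot_valE (w : S (munit^⋆)) : bot_val S w = pair w (eps 1).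
Proof.
by rewrite /bot_val linear_lfunE // => a x y; rewrite lfunD lfunZ evDl evZl.
Qed.

Lemma unit_valK : cancel (unit_val S) (seps S).
Proof. exact: bij_lfunVK (seps_bij S). Qed.

Lemma unit_val_eps r : unit_val S (eps r) = r.
Proof. exact: bij_lfunK (seps_bij S) r. Qed.

Lemma pair_extl c (w w' : S (c^⋆)) : (forall v, pair w v = pair w' v) -> w = w'.
Proof. by move=> h; apply: (can_inj (@kappaK c)); exact: ldual_ext. Qed.

Lemma pair_extr c (v v' : S c) : (forall w, pair w v = pair w v') -> v = v'.
Proof.
move=> h; rewrite (dual_basis_sum v) (dual_basis_sum v').
by apply: eq_bigr => i _; have := h ((skappa S c)^-1 (dual_basis i))%VF; rewrite kappaVK => ->.
Qed.

Lemma iso_smorK (a b : C) (f : mor a b) : is_iso f -> exists g : mor b a,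
  cancel (smor S f) (smor S g) /\ cancel (smor S g) (smor S f).
Proof.
move=> [g [gf fg]]; exists g.
by split=> v; rewrite -smor_comp ?gf ?fg smor_id.
Qed.

Lemma lunit_inv a : exists f : mor a (munit ⊗ a), forall v, smor S f v = mu (eps 1) v.
Proof.
have [f [lf _]] := iso_smorK (lunit_iso a); exists f => v.
by rewrite -[RHS]lf smu_lunit scale1r.
Qed.

Lemma runit_inv a : exists f : mor a (a ⊗ munit), forall v, smor S f v = mu v (eps 1).
Proof.
have [f [rf _]] := iso_smorK (runit_iso a); exists f => v.
by rewrite -[RHS]rf smu_runit scale1r.
Qed.

(** This is the right unitor [c ⊗ 1 -> c] after currying: [scur] turns the unit law
    into the defining property of the map from [S c] to its bidual. *)
Lemma bidual c : exists f : mor c (c^⋆^⋆), forall v w, pair (smor S f v) w = pair w v.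
Proof.
have [l lE] := lunit_inv (c^⋆).
exists (dmor l ∘ cur (runit c)) => v w.
by rewrite smor_comp skappa_nat lE scur smu_runit scale1r.
Qed.

Lemma cur_surj (a b c : C) (g : mor a ((b ⊗ c^⋆)^⋆)) : exists h : mor (a ⊗ b) c, cur h = g.
Proof. by have [f _ fK] := @cur_bij C a b c; exists (f g). Qed.

(** Currying is onto, so the identity of [(1 ⊗ c^⋆)^⋆] is the curried form of some
    morphism from [(1 ⊗ c^⋆)^⋆ ⊗ 1] to [c]. *)
Lemma bidual_inv c : exists f : mor (c^⋆^⋆) c, forall z w, pair w (smor S f z) = pair z w.
Proof.
have [h hE] := cur_surj (idm ((munit ⊗ c^⋆)^⋆)).
have [r rE] := runit_inv ((munit ⊗ c^⋆)^⋆).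
exists (h ∘ (r ∘ dmor (lunit (c^⋆)))) => z w.
by rewrite !smor_comp rE -scur hE smor_id skappa_nat smu_lunit scale1r.
Qed.

(** The curried form of [f] takes values in [(b ⊗ 1^⋆^⋆)^⋆]; the dual of
    [b -> b ⊗ 1 -> b ⊗ 1^⋆^⋆] brings it back to [b^⋆]. *)
Lemma pairing_transpose (a b : C) (f : mor (a ⊗ b) (munit^⋆)) :
  exists g : mor a (b^⋆), forall u v, pair (smor S g u) v = bot_val S (smor S f (mu u v)).
Proof.
have [d dE] := bidual munit; have [r rE] := runit_inv b.
exists (dmor ((idm b ⊗m d) ∘ r) ∘ cur f) => u v.
rewrite smor_comp skappa_nat smor_comp rE smu_nat smor_id scur dE.
by rewrite bot_valE.
Qed.

(** The roles of [a] and [b] are exchanged by dualizing [a -> b^⋆] and precomposing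
    with [b -> b^⋆^⋆]; in this way the flip of tensor factors is never taken from
    the braiding, whose image under [S] is unspecified. *)
Lemma pairing_transpose_swap (a b : C) (f : mor (a ⊗ b) (munit^⋆)) :
  exists g : mor b (a^⋆), forall u v, pair (smor S g v) u = bot_val S (smor S f (mu u v)).
Proof.
have [g gE] := pairing_transpose f; have [d dE] := bidual b.
exists (dmor g ∘ d) => u v.
by rewrite smor_comp skappa_nat dE gE.
Qed.

(** The pairing whose transpose is [c -> c^⋆^⋆], obtained by uncurrying. *)
Lemma evaluation c : exists f : mor (c ⊗ c^⋆) (munit^⋆),
  forall v w, bot_val S (smor S f (mu v w)) = pair w v.
Proof.
have [d dE] := bidual c; have [d1 d1E] := bidual munit; have [j jE] := bidual_inv munit.
have [h hE] := cur_surj (dmor (runit (c^⋆) ∘ (idm (c^⋆) ⊗m j)) ∘ d).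
exists h => v w.
rewrite bot_valE -d1E -scur hE smor_comp skappa_nat dE smor_comp smu_nat smor_id.
have -> : smor S j (smor S d1 (eps 1)) = eps 1.
  by apply: pair_extr => u; rewrite jE d1E.
by rewrite smu_runit scale1r.
Qed.

Lemma unit_par (d e : C) (Th : mor munit (d ⅋ e)) : exists h : mor (d^⋆) e,
  forall f g, pair (smor S Th (eps 1)) (mu f g) = pair g (smor S h f).
Proof.
have [h <-] := cur_surj Th; have [l lE] := lunit_inv (d^⋆).
by exists (h ∘ l) => f g; rewrite smor_comp lE scur.
Qed.

(** The curried form of the left unitor [1 ⊗ d^⋆ -> d^⋆]. *)
Lemma coevaluation d : exists Th : mor munit (d ⅋ d^⋆),
  forall f g, pair (smor S Th (eps 1)) (mu f g) = pair g f.
Proof.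
by exists (cur (lunit (d^⋆))) => f g; rewrite scur smu_lunit scale1r.
Qed.

Lemma smu_ext (a b : C) (f g : ldual (S (a ⊗ b))) :
  (forall u v, ev f (mu u v) = ev g (mu u v)) -> f = g.
Proof.
move=> fg; apply: ldual_ext => z; have [h _ hK] := smu_bij S a b; rewrite -(hK z).
elim/tens_ind: (h z) => [s t IHs IHt|u v]; last exact: fg.
by rewrite lfunD !evDr IHs IHt.
Qed.

(** Elements of [S (d ⅋ e)] as linear maps [S (d^⋆) -> S e]. *)
Lemma par_slice (d e : C) : exists D : S (d ⅋ e) -> 'Hom(S (d^⋆), S e),
  forall z f g, pair g (D z f) = pair z (mu f g).
Proof.
have [j jE] := bidual_inv e.
exists (fun z => smor S j \o (skappa S (e^⋆))^-1 \o
  curry (skappa S _ z \o smu S (d^⋆) (e^⋆) : ldual (tens _ _)))%VF => z f g.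
by rewrite !comp_lfunE jE kappaVK curryE /ev comp_lfunE.
Qed.

Lemma spar_pure (d e : C) v w f g :
  pair (spar S d e (pure v w)) (mu f g) = pair f v * pair g w.
Proof.
have b x y : bilin (fun f g => pair f x * pair g y : R^o) (V := S (d^⋆)) (W := S (e^⋆)).
  by split=> z a s t; rewrite lfunD lfunZ evDl evZl /GRing.scale /=; ring.
rewrite /spar comp_lfunE kappaVK tlift_pure.
  by rewrite /ev comp_lfunE (bij_lfunK (smu_bij S _ _)) tlift_pure //; exact: b.
have [bl br] : bilin (fun (x : S d) (y : S e) =>
    tlift (fun (f : S (d^⋆)) (g : S (e^⋆)) => pair f x * pair g y : R^o)).
  by apply: tlift_bilin => u t; exact: ev_bilin.
by split=> [y|x] a s t; rewrite ?bl ?br comp_lfunDl comp_lfunZl.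
Qed.

Lemma dual_id_pure X c (f : ldual X) (v : S c) x w :
  ev (dual_id S X c (pure f v)) (pure x w) = ev f x * pair w v.
Proof.
have b (h : ldual X) (y : S c) : bilin (fun (x : X) w => ev h x * pair w y : R^o).
  by split=> z a s t; rewrite ?lfunD ?lfunZ ?evDl ?evZl ?evDr ?evZr /GRing.scale /=; ring.
have bb : bilin (fun (f : ldual X) (v : S c) =>
    tlift (fun (x : X) (w : S (c^⋆)) => ev f x * pair w v : R^o)).
  apply: tlift_bilin => u t.
  by split=> z a s s'; rewrite ?evDl ?evZl ?evDr ?evZr /GRing.scale /=; ring.
rewrite /dual_id tlift_pure; last exact: bb.
by rewrite /ev tlift_pure; last exact: b. 
Qed.

Lemma at_unit_pure X x r : at_unit S X (pure x (eps r)) = r *: x.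
Proof.
rewrite /at_unit tlift_pure ?unit_val_eps //.
split=> [w|y] a s t; first by rewrite scalerDr !scalerA mulrC.
by rewrite lfunD lfunZ scalerDl scalerA.
Qed.

Lemma at_bot_pure X x w : at_bot S X (pure x w) = (bot_val S w : R) *: x.
Proof.
rewrite /at_bot tlift_pure //.
split=> [z|y] a s t; first by rewrite scalerDr !scalerA mulrC.
by rewrite lfunD lfunZ scalerDl scalerA.
Qed.

(** The vector [w] is the element of [S (1^⋆)] that corresponds to 1 in [R]. *)
Lemma at_bot_cancel X : exists w : S (munit^⋆),
  cancel (at_bot S X) (fun x => pure x w) /\ cancel (fun x => pure x w) (at_bot S X).
Proof.
pose w := ((skappa S munit)^-1 (unit_val S : ldual _))%VF.
have w1 : bot_val S w = 1 by rewrite bot_valE kappaVK /ev unit_val_eps.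
exists w; split=> [t|x]; last by rewrite at_bot_pure w1 scale1r.
elim/tens_ind: t => [s t IHs IHt|x u].
  by rewrite lfunD pureDl IHs IHt.
rewrite at_bot_pure pureZl -pureZr; congr pure.
apply: pair_extl => v; rewrite lfunZ evZl kappaVK /ev -[v in RHS]unit_valK.
rewrite bot_valE -[unit_val S v in RHS]mulr1 -[(_ * 1)%R]/(_ *: (1 : R^o)).
by rewrite lfunZ -[RHS]/(ev _ _) evZr mulrC.
Qed.

End Stem.

(** * Systems, their duals, and the maximal tensor product *)

Section SystemsTheory.
Variables (R : realType) (C : starcat) (S : stem R C).
Implicit Types X Y : vectType R.

Local Notation pair w v := (ev (skappa S _ w) v).
Local Notation mu u v := (smu S _ _ (pure u v)).
Local Notation eps r := (seps S r).

Lemma smor_idm (c : C) : smor S (idm c) = \1%VF.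
Proof. by apply/lfunP => v; rewrite smor_id id_lfunE. Qed.

Lemma tmap_id X Y : tmap \1%VF \1%VF = \1%VF :> 'Hom(tens X Y, tens X Y).
Proof. by apply: tens_ext => v w; rewrite tmap_pure !id_lfunE. Qed.

Lemma Acone_smor (c d : C) (f : mor c d) v : Acone S c v -> Acone S d (smor S f v).
Proof. by move=> Av phi; rewrite -smor_comp. Qed.

(** With [g] a transpose of [f], this turns membership in [A (c ⊗ e)], tested by all
    [f], into membership in the dual system, tested on the images under all [g]. *)
Lemma tens_lin_dual_id X (c e : C) (f : mor (c ⊗ e) (munit^⋆)) (g : mor e (c^⋆))
    (s : tens (ldual X) (S c)) (t : tens X (S e)) :
  (forall u v, pair (smor S g v) u = bot_val S (smor S f (mu u v))) ->
  bot_val S (smor S f (smu S c e (tmap (tens_lin X (S c) s) \1%VF t))) =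
  ev (dual_id S X c s) (tmap \1%VF (smor S g) t).
Proof.
move=> gE; elim/tens_ind: s => [s s' IHs IHs'|h v].
  by rewrite !lfunD tmapDl !lfunD evDl IHs IHs'.
elim/tens_ind: t => [t t' IHt IHt'|x u].
  by rewrite !lfunD evDr IHt IHt'.
rewrite !tmap_pure !id_lfunE tens_lin_pure dual_id_pure gE.
by rewrite pureZl !lfunZ.
Qed.

(** The same identity with the transpose [g] leaving from the other factor, for
    tensors that are sent by [slice] instead of [tens_lin]. *)
Lemma slice_dual_id X (c e : C) (f : mor (c ⊗ e) (munit^⋆)) (g : mor c (e^⋆))
    (t : tens X (S c)) (s : tens (ldual X) (S e)) :
  (forall u v, pair (smor S g u) v = bot_val S (smor S f (mu u v))) ->
  bot_val S (smor S f (smu S c e (tmap (slice X (S c) t) \1%VF s))) =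
  ev (dual_id S X e s) (tmap \1%VF (smor S g) t).
Proof.
move=> gE; elim/tens_ind: t => [t t' IHt IHt'|x u].
  by rewrite !lfunD tmapDl !lfunD evDr IHt IHt'.
elim/tens_ind: s => [s s' IHs IHs'|h v].
  by rewrite !lfunD evDl IHs IHs'.
rewrite !tmap_pure !id_lfunE slice_pure dual_id_pure gE.
by rewrite pureZl !lfunZ.
Qed.

(** It suffices to test [Psi] against the evaluation [c ⊗ c^⋆ -> 1^⋆]. *)
Lemma CP_Asys_dual_sys X (G : sfamily S X) (c : C) (Psi : 'Hom(X, S c)) :
  CP G (Asys S c) Psi -> dual_sys G c (lin_tens Psi).
Proof.
move=> PsiCP t Gt; have [f fE] := evaluation S c.
have := PsiCP _ _ Gt f; rewrite -{1}[Psi]lin_tensK.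
rewrite (@tens_lin_dual_id _ _ _ _ (idm _)) => [|u v].
  by rewrite smor_idm tmap_id id_lfunE.
by rewrite smor_id fE.
Qed.

Lemma dual_sys_CP_Asys X (G : sfamily S X) (c : C) s :
  is_system G -> dual_sys G c s -> CP G (Asys S c) (tens_lin X (S c) s).
Proof.
move=> HG Gs e t Gt f; have [g gE] := pairing_transpose_swap S f.
by rewrite (tens_lin_dual_id _ _ gE); apply: Gs; exact: HG.2.
Qed.

Lemma slice_CP X (G : sfamily S X) (c : C) t :
  is_system G -> G c t -> CP (dual_sys G) (Asys S c) (slice X (S c) t).
Proof.
move=> HG Gt e s Gs f; have [g gE] := pairing_transpose S f.
by rewrite (slice_dual_id _ _ gE); apply: Gs; exact: HG.2.
Qed.

(** The map [X -> S (c^⋆)] given by a functional on [X ⊗ S c]. *)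
Definition functional_map X (c : C) (phi : ldual (tens X (S c))) : 'Hom(X, S (c^⋆)) :=
  ((skappa S c)^-1 \o curry phi)%VF.

Lemma functional_mapE X (c : C) (phi : ldual (tens X (S c))) x v :
  pair (functional_map phi x) v = ev phi (pure x v).
Proof. by rewrite comp_lfunE kappaVK curryE. Qed.

(** A pairing [f] of [c^⋆ ⊗ d] has a transpose [d -> c^⋆^⋆]; corrected to a morphism
    [d -> c] it maps [t] into [G c], where [phi] is nonnegative. *)
Lemma functional_map_CP X (G : sfamily S X) (c : C) (phi : ldual (tens X (S c))) :
  is_system G -> dual_cone (G c) phi -> CP G (Asys S (c^⋆)) (functional_map phi).
Proof.
move=> HG Gphi d t Gt f; have [g gE] := pairing_transpose_swap S f.
have [j jE] := bidual_inv S c.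
have := HG.2 _ _ (j ∘ g) _ Gt => /Gphi.
congr (0 <= _); elim/tens_ind: t {Gt} => [t t' IHt IHt'|x v].
  by rewrite !lfunD evDr IHt IHt'.
by rewrite !tmap_pure !id_lfunE -functional_mapE smor_comp jE gE.
Qed.

Lemma max_tens_unit X Y (G : sfamily S X) (E : sfamily S Y) :
  is_system G -> is_system E ->
  [set tens_lin X Y (at_unit S (tens (ldual X) Y) t)
    | t in max_tens (dual_sys G) E munit] = CP G E.
Proof.
move=> HG HE; apply/seteqP; split=> [_ [T Tmax <-]|Psi PsiCP].
- move=> c t Gt; apply: (bipolar (HE.1 c)) => phi Ephi.
  have [f fE] := evaluation S c.
  have := Tmax _ _ _ _ (slice_CP HG Gt) (functional_map_CP HE Ephi) (f ∘ runit _).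
  (* Both sides are linear in the tensors T and t. *)
  congr (0 <= _).
  elim/tens_ind: T {Tmax} => [T T' IHT IHT'|s w].
    by rewrite !lfunD tmapDl evDr IHT IHT'.
  rewrite -[w]unit_valK; move: (unit_val S w) => r.
  rewrite at_unit_pure tmap_pure id_lfunE smor_comp smu_runit.
  rewrite (lfunZ (tens_lin X Y)).
  elim/tens_ind: s => [s s' IHs IHs'|h y].
    by rewrite !lfunD scalerDr lfunD scalerDr !lfunD tmapDl evDr IHs IHs'.
  elim/tens_ind: t {Gt} => [t t' IHt IHt'|x v].
    rewrite !comp_lfunE !lfunD evDr -IHt -IHt' !comp_lfunE.
    by rewrite !tmap_pure !add_lfunE pureDl !lfunD scalerDr !lfunD.
  rewrite comp_lfunE !tmap_pure id_lfunE scale_lfunE tens_lin_pure slice_pure.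
  rewrite !lfunZ fE evZr functional_mapE !pureZl !evZr.
  by rewrite /GRing.scale /=.
- exists (pure (lin_tens Psi) (eps 1)); last by rewrite at_unit_pure scale1r lin_tensK.
  move=> c1 c2 Psi1 Psi2 CP1 CP2.
  have CP3 : CP G (Asys S c2) (Psi2 \o Psi)%VF.
    move=> c t Gt; have := CP2 _ _ (PsiCP _ _ Gt).
    by rewrite -tmap_comp comp_lfun1l.
  have := CP1 _ _ (CP_Asys_dual_sys CP3).
  rewrite -tmap_lin_tens -tmap_comp comp_lfun1l comp_lfun1r => A12.
  have [r rE] := runit_inv S (c1 ⊗ c2).
  have := Acone_smor r A12; rewrite rE.
  by rewrite /preim_sys /Asys /= tmap_pure id_lfunE comp_lfunE.
Qed.

End SystemsTheory.

(** * The minimal tensor product *)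

Section MinimalTensor.
Variables (R : realType) (C : starcat) (S : stem R C).
Implicit Types X Y : vectType R.

Local Notation pair w v := (ev (skappa S _ w) v).
Local Notation mu u v := (smu S _ _ (pure u v)).
Local Notation eps r := (seps S r).

Definition pairing (a b : C) (f : mor (a ⊗ b) (munit^⋆)) : ldual (tens (S a) (S b)) :=
  (bot_val S \o smor S f \o smu S a b)%VF.

Lemma pairingE (a b : C) (f : mor (a ⊗ b) (munit^⋆)) u v :
  ev (pairing f) (pure u v) = bot_val S (smor S f (mu u v)).
Proof. by rewrite /ev !comp_lfunE. Qed.

Lemma bot_contraction X Y (a b : C) (f : mor (a ⊗ b) (munit^⋆))
    (s : tens (ldual X) (S a)) (t : tens Y (S b)) :
  tens_lin X Y (at_bot S (tens (ldual X) Y)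
    (tmap \1%VF (smor S f) (tmap \1%VF (smu S a b)
      (tswap (ldual X) (S a) Y (S b) (pure s t))))) =
  (contr Y (pairing f) t \o tens_lin X (S a) s)%VF.
Proof.
elim/tens_ind: s => [s s' IHs IHs'|h v].
  by rewrite pureDl !lfunD IHs IHs' comp_lfunDr.
elim/tens_ind: t => [t t' IHt IHt'|y u].
  by rewrite pureDr !lfunD IHt IHt' comp_lfunDl.
rewrite tswap_pure !tmap_pure !id_lfunE at_bot_pure lfunZ -pairingE.
apply/lfunP => x; rewrite comp_lfunE scale_lfunE !tens_lin_pure lfunZ contr_pure.
by rewrite !scalerA mulrC.
Qed.

(** The cone [B (a ⅋ e)] is generated by the values of morphisms [1 -> a ⅋ e], that is,
    of morphisms [h : a^⋆ -> e].  On such a value the map acts as [id ⊗ S (h ∘ k)]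
    on [t], where [k : b -> a^⋆] is a transpose of [f], and [h ∘ k] preserves the
    system [E]. *)
Lemma contr_CP Y (E : sfamily S Y) (a b : C) (f : mor (a ⊗ b) (munit^⋆)) t :
  is_system E -> E b t -> CP (Bsys S a) E (contr Y (pairing f) t).
Proof.
move=> HE Et e tau.
have [D DE] := par_slice S a e; have [k kE] := pairing_transpose_swap S f.
have Dlin : linear D.
  move=> r z z'; apply/lfunP => w; apply: pair_extr => g.
  by rewrite add_lfunE scale_lfunE evDr evZr !DE lfunD lfunZ evDl evZl.
(* The map L is defined on all of S (a ⅋ e), where the generators of the cone
   live, and agrees with the given map through spar. *)
pose L := linfun (fun z => tmap \1%VF (D z \o smor S k)%VF t).
have LE z : L z = tmap \1%VF (D z \o smor S k)%VF t.
  rewrite linear_lfunE // => r z1 z2.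
  by rewrite Dlin comp_lfunDl -comp_lfunZl tmap_linearr add_lfunE scale_lfunE.
have L_gen : Bcone S (a ⅋ e) `<=` [set z | E e (L z)].
  apply: closed_conic_hull_min => [|_ [Th ->]].
    by apply: closed_convex_cone_preimage; exact: HE.1.
  have [h hE] := unit_par S Th.
  rewrite /= LE; have -> : (D (smor S Th (eps 1)) \o smor S k = smor S (h ∘ k))%VF.
    apply/lfunP => u; rewrite comp_lfunE smor_comp; apply: pair_extr => g.
    by rewrite DE hE.
  exact: HE.2.
rewrite /Bsys /= => /L_gen /=; rewrite LE.
congr (E e _); elim/tens_ind: tau => [tau tau' IHt IHt'|v w].
  rewrite !lfunD -IHt -IHt'.
  have := Dlin 1 (spar S a e tau) (spar S a e tau'); rewrite !scale1r => ->.
  rewrite comp_lfunDl.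
  have := tmap_linearr (\1%VF : 'Hom(Y, Y)) 1 (D (spar S a e tau) \o smor S k)%VF
    (D (spar S a e tau') \o smor S k)%VF.
  by rewrite !scale1r => ->; rewrite add_lfunE.
rewrite tmap_pure id_lfunE; elim/tens_ind: t {Et L LE L_gen} => [t t' IHt IHt'|y u].
  by rewrite !lfunD IHt IHt' add_lfunE pureDl.
rewrite tmap_pure id_lfunE contr_pure pairingE -kE pureZl -pureZr; congr pure.
by apply: pair_extr => g; rewrite comp_lfunE DE spar_pure evZr.
Qed.

(** The identity of [S c], seen as an element of [S c ⊗ S (c^⋆)]. *)
Definition identity_tens (c : C) : tens (S c) (S (c^⋆)) :=
  \sum_(i < \dim {:S c}) pure (vbasis {:S c})`_i ((skappa S c)^-1 (dual_basis i))%VF.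

(** The identity tensor is the value of the coevaluation. *)
Lemma Bsys_identity_tens (c : C) : Bsys S c (c^⋆) (identity_tens c).
Proof.
have [Th ThE] := coevaluation S c.
apply: sub_closed_conic_hull; exists Th; apply: pair_extl => z.
suff -> : skappa S _ (spar S c (c^⋆) (identity_tens c)) = skappa S _ (smor S Th (eps 1)) by [].
apply: smu_ext => f g; rewrite ThE /identity_tens lfun_sum lfun_sum ev_suml.
rewrite -[f in RHS]kappaK (ldual_basis_sum (skappa S c f)) !lfun_sum ev_sumr.
by apply: eq_bigr => i _; rewrite spar_pure !lfunZ evZr.
Qed.

Lemma contr_identity_tens Y (c : C) (f : mor (c ⊗ c^⋆) (munit^⋆)) (Psi : 'Hom(S c, Y)) :
  (forall v w, bot_val S (smor S f (mu v w)) = pair w v) ->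
  contr Y (pairing f) (tmap Psi \1%VF (identity_tens c)) = Psi.
Proof.
move=> fE; apply/lfunP => v; rewrite !lfun_sum sum_lfunE [v in RHS]dual_basis_sum lfun_sum.
apply: eq_bigr => i _.
by rewrite tmap_pure id_lfunE contr_pure pairingE fE kappaVK lfunZ.
Qed.

Lemma tmap_smor_comp X (a b c : C) (g : mor b c) (f : mor a b) (t : tens X (S a)) :
  tmap \1%VF (smor S (g ∘ f)) t = tmap \1%VF (smor S g) (tmap \1%VF (smor S f) t).
Proof.
rewrite -tmap_comp comp_lfun1l; congr (tmap _ _ _).
by apply/lfunP => v; rewrite smor_comp comp_lfunE.
Qed.

Definition factorizable X Y (G : sfamily S X) (E : sfamily S Y) : set 'Hom(X, Y) :=
  [set Psi | exists (c : C) (Psi1 : 'Hom(X, S c)) (Psi2 : 'Hom(S c, Y)),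
     [/\ CP G (Asys S c) Psi1, CP (Bsys S c) E Psi2 & Psi = (Psi2 \o Psi1)%VF]].

(** The family [K] of tensors all of whose images at [1^⋆] lie in the closed hull is a
    system by construction, and contains the products of [G^∨] and [E]; it thus
    contains the smallest such system. *)
Lemma min_tens_bot_sub X Y (G : sfamily S X) (E : sfamily S Y) T :
  is_system G -> is_system E -> min_tens (dual_sys G) E (munit^⋆) T ->
  closed_conic_hull (factorizable G E)
    (tens_lin X Y (at_bot S (tens (ldual X) Y) T)).
Proof.
move=> HG HE.
pose N : set 'Hom(X, Y) := closed_conic_hull (factorizable G E).
have Ncone : closed_convex_cone N := closed_conic_hull_cone _.
pose L := (tens_lin X Y \o at_bot S (tens (ldual X) Y))%VF.
pose K (c : C) : set (tens (tens (ldual X) Y) (S c)) :=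
  [set T | forall f : mor c (munit^⋆), N ((L \o tmap \1%VF (smor S f))%VF T)].
have Ksys : is_system (K : sfamily S _).
  split=> [c|c d Phi t Kt f].
    by apply: closed_convex_cone_bigcap => f; exact: closed_convex_cone_preimage.
  by have := Kt (f ∘ Phi); rewrite !comp_lfunE tmap_smor_comp.
have Kcont : contains_tens (dual_sys G) E K.
  move=> c1 c2 _ [n [s [t [Gs Et ->]]]] f; rewrite !lfun_sum.
  apply: convex_cone_sum => [|i]; first exact: Ncone.1.
  apply: sub_closed_conic_hull; exists c1, (tens_lin X (S c1) (s i)),
    (contr Y (pairing f) (t i)); split.
  - exact: dual_sys_CP_Asys.
  - exact: contr_CP.
  - by rewrite !comp_lfunE bot_contraction.
move=> /(min_tens_le Ksys Kcont) /(_ (idm _)).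
by rewrite smor_idm tmap_id !comp_lfunE id_lfunE.
Qed.

Lemma factorizable_min_tens X Y (G : sfamily S X) (E : sfamily S Y) Psi :
  is_system G -> factorizable G E Psi ->
  exists2 T, min_tens (dual_sys G) E (munit^⋆) T &
    tens_lin X Y (at_bot S (tens (ldual X) Y) T) = Psi.
Proof.
move=> HG [c [Psi1 [Psi2 [CP1 CP2 ->]]]]; have [f fE] := evaluation S c.
pose t := tmap Psi2 \1%VF (identity_tens c).
exists (tmap \1%VF (smor S f) (tmap \1%VF (smu S c (c^⋆))
  (tswap (ldual X) (S c) Y (S (c^⋆)) (pure (lin_tens Psi1) t)))).
  apply: (min_tens_system _ _).2; apply: min_tens_contains.
  exists 1%N, (fun=> lin_tens Psi1), (fun=> t); split=> [_|_|].
  - exact: CP_Asys_dual_sys.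
  - by apply: CP2; exact: Bsys_identity_tens.
  - by rewrite big_ord1.
by rewrite bot_contraction lin_tensK contr_identity_tens.
Qed.

(** The reverse inclusion passes from factorizable maps to their closed hull because
    [tens_lin] after [at_bot] is a linear isomorphism, whose inverse [M] pulls the
    closed cone of the minimal tensor product back to a closed cone. *)
Lemma min_tens_bot X Y (G : sfamily S X) (E : sfamily S Y) :
  is_system G -> is_system E ->
  [set tens_lin X Y (at_bot S (tens (ldual X) Y) t)
    | t in min_tens (dual_sys G) E (munit^⋆)] =
  closed_conic_hull (factorizable G E).
Proof.
move=> HG HE; apply/seteqP; split=> [_ [T Tmin <-]|Psi].
  exact: min_tens_bot_sub.
have [w [wK Kw]] := at_bot_cancel S (tens (ldual X) Y).
have minS := min_tens_system (dual_sys G) E.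
pose M : 'Hom('Hom(X, Y), tens (tens (ldual X) Y) (S (munit^⋆))) :=
  ((tens_lin X Y \o at_bot S (tens (ldual X) Y))^-1)%VF.
have Lbij : bijective (tens_lin X Y \o at_bot S (tens (ldual X) Y))%VF.
  exists (fun Psi => pure (lin_tens Psi) w) => [t|Phi]; rewrite comp_lfunE.
    by rewrite tens_linK wK.
  by rewrite Kw lin_tensK.
have sub : closed_conic_hull (factorizable G E) `<=`
    [set Phi | min_tens (dual_sys G) E (munit^⋆) (M Phi)].
  apply: closed_conic_hull_min => [|Phi /(factorizable_min_tens HG) [T Tmin <-]].
    by apply: closed_convex_cone_preimage; exact: minS.1.
  by rewrite /= -[tens_lin X Y _](comp_lfunE _ _ T) /M bij_lfunK.
move=> /sub MPsi; exists (M Psi) => //.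
by rewrite -[LHS](comp_lfunE _ _ (M Psi)) bij_lfunVK.
Qed.

End MinimalTensor.

Theorem theorem3p33 (R : realType) (C : starcat) (S : stem R C)
  (HA : forall (c d : C) t,
     cone_tens (Acone S c) (Acone S d) t -> Acone S (c ⊗ d) (smu S c d t))
  (X Y : vectType R) (G : sfamily S X) (E : sfamily S Y)
  (HG : is_system G) (HE : is_system E) :
  [set tens_lin X Y (at_unit S (tens (ldual X) Y) t)
    | t in max_tens (dual_sys G) E munit] = CP G E
  /\
  [set tens_lin X Y (at_bot S (tens (ldual X) Y) t)
    | t in min_tens (dual_sys G) E (munit^⋆)] =
  closed_conic_hull
    [set Psi : 'Hom(X, Y) | exists (c : C)
       (Psi1 : 'Hom(X, S c)) (Psi2 : 'Hom(S c, Y)),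
       [/\ CP G (Asys S c) Psi1, CP (Bsys S c) E Psi2
         & Psi = (Psi2 \o Psi1)%VF]].
Proof. by split; [exact: max_tens_unit|exact: min_tens_bot]. Qed.
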